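(* Let $m,n,N$ be positive integers with $n+1\le N$, let $\Sigma_0,\dots,\Sigma_n\in\mathbb{R}^{m\times m}$ be given, and let $\Sigma_{11}\in\mathbb{R}^{(n+1)m\times(n+1)m}$ be the symmetric block-Toeplitz matrix whose first block row is $[\Sigma_0\mid\Sigma_1^\top\mid\dots\mid\Sigma_n^\top]$. Let $\Sigma_p\in\mathbb{R}^{Nm\times Nm}$ be a symmetric positive definite matrix (the prior). Consider the problem of minimizing $$F(\Sigma):=\log\det(\Sigma^{-1}\Sigma_p)+\mathrm{tr}(\Sigma_p^{-1}\Sigma)$$ over $\mathcal{W}\cap\mathcal{S}$, where $\mathcal{S}$ is the cone of symmetric positive definite matrices in $\mathbb{R}^{Nm\times Nm}$ and $$\mathcal{W}:=\{\Sigma=\Sigma^\top\in\mathbb{R}^{Nm\times Nm}:\ E^\top\Sigma E=\Sigma_{11},\ U^\top\Sigma U=\Sigma\}.$$ If $\Sigma_c$ is an optimal solution of this problem, then it has the form $$\Sigma_c=\left(E\Lambda E^\top+U\Theta U^\top-\Theta+\Sigma_p^{-1}\right)^{-1}$$ for some $\Lambda=\Lambda^\top\in\mathbb{R}^{(n+1)m\times(n+1)m}$ and $\Theta=\Theta^\top\in\mathbb{R}^{Nm\times Nm}$.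
   Context: $I_m$ is the $m\times m$ identity matrix. $U\in\mathbb{R}^{Nm\times Nm}$ is the block cyclic shift with $N\times N$ blocks of size $m\times m$: its blocks in positions $(i,i+1)$, $i=1,\dots,N-1$, and in position $(N,1)$ equal $I_m$, and all other blocks are zero. It is orthogonal, and a matrix $C$ with $N\times N$ blocks of size $m\times m$ is block-circulant if and only if $U^\top CU=C$. $E\in\mathbb{R}^{Nm\times(n+1)m}$ is the matrix whose first $(n+1)m$ rows form the identity matrix and whose remaining rows are zero, so $E^\top\Sigma E$ is the north-west corner of $\Sigma$ of size $(n+1)m\times(n+1)m$. Thus $\mathcal{W}$ is the affine space of symmetric block-circulant matrices whose north-west $(n+1)m\times(n+1)m$ corner equals $\Sigma_{11}$. *)

(* Defs.v *)
From mathcomp Require Import all_boot all_order all_algebra.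
From mathcomp Require Import all_classical all_reals all_analysis.

Set Implicit Arguments.
Unset Strict Implicit.
Unset Printing Implicit Defensive.

Import Order.TTheory GRing.Theory Num.Theory.

Local Open Scope classical_set_scope.
Local Open Scope ring_scope.

(* The dimension k * m is written as the k-fold sum of m, which is the index   *)
(* type of \mxblock with k blocks of constant size m: row number r of block i  *)
(* is row number i * m + r of the whole matrix.                                *)
Definition bdim (k m : nat) : nat := (\sum_(i < k) m)%N.

(* Block (i, j) with i > j is Sigma_(i - j); block (i, j) with i < j is the    *)
(* transpose of Sigma_(j - i). The matrix is symmetric iff Sigma_0 is.         *)
Definition block_toeplitz (R : realType) (m n : nat)
    (Sigma : 'I_n.+1 -> 'M[R]_m) : 'M[R]_(bdim n.+1 m) :=
  \mxblock_(i < n.+1, j < n.+1)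
    (if (i < j)%N then (Sigma (inord (j - i)%N))^T else Sigma (inord (i - j)%N)).

Definition cyclic_shift (R : realType) (N m : nat) : 'M[R]_(bdim N m) :=
  \mxblock_(i < N, j < N)
    (if j == (i.+1 %% N)%N :> nat then 1%:M else 0 : 'M[R]_m).

Definition corner_embedding (R : realType) (N n m : nat) :
    'M[R]_(bdim N m, bdim n.+1 m) :=
  \matrix_(i, j) (i == j :> nat)%:R.

Definition posdefmx (R : realType) (d : nat) : set 'M[R]_d :=
  [set A | A^T = A /\
           forall v : 'cV[R]_d, v != 0 -> 0 < (v^T *m A *m v) 0 0].

Definition circulant_extensions (R : realType) (N n m : nat)
    (Sigma11 : 'M[R]_(bdim n.+1 m)) : set 'M[R]_(bdim N m) :=
  let E := corner_embedding R N n m in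
  let U := cyclic_shift R N m in
  [set S | [/\ S^T = S, E^T *m S *m E = Sigma11 & U^T *m S *m U = S]].

Definition objective (R : realType) (d : nat) (Sigma_p S : 'M[R]_d) : R :=
  ln (\det (invmx S *m Sigma_p)) + \tr (invmx Sigma_p *m S).

Definition is_minimizer (R : realType) (T : Type) (F : T -> R) (A : set T)
    (x : T) : Prop :=
  A x /\ forall y, A y -> F x <= F y.

(* Main.v *)
Require Import Defs.
From mathcomp Require Import all_boot all_order all_algebra.
From mathcomp Require Import all_classical all_reals all_analysis.
From mathcomp Require Import perm ring lra.

(* First-order optimality along the directions D with D^T = D, E^T D E = 0    *)
(* and U^T D U = D says that G = Sigma_c^-1 - Sigma_p^-1 is orthogonal to all *)
(* of them. These directions are the symmetric matrices annihilated by the    *)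
(* Frobenius adjoints of Lambda |-> E Lambda E^T and                          *)
(* Theta |-> U Theta U^T - Theta, so G lies in the sum of the images of these *)
(* two maps; since G is symmetric, Lambda and Theta can be symmetrized.       *)

Set Implicit Arguments.
Unset Strict Implicit.
Unset Printing Implicit Defensive.

Import Order.TTheory GRing.Theory Num.Theory.
Import numFieldNormedType.Exports.

Local Open Scope classical_set_scope.
Local Open Scope ring_scope.

(** Positive definiteness is an open condition ([posdef_open]) and the linear constraints persist
    along [Sigma_c + t *: D] for every admissible direction [D], so minimality at [t = 0] gives
    tr(Sigma_c^-1 D) = tr(Sigma_p^-1 D) ([objective_stationary]). The derivative of log det is
    obtained through polynomials in [t]: [deriv_det_pencil1] computes it and [posdef_det_gt0] makes
    the logarithms meaningful. The multipliers then come from [sum_images_of_orthogonal], applied to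
    the two constraint maps. *)

(** * Orthogonality for the Frobenius pairing *)

Lemma mxtrace_mxvec (R : comPzRingType) (p q : nat) (A B : 'M[R]_(p, q)) :
  \tr (A^T *m B) = (mxvec A *m (mxvec B)^T) 0 0.
Proof.
rewrite /mxtrace mxE (reindex _ (curry_mxvec_bij p q)) /=.
rewrite [RHS](_ : _ = \sum_(ij : 'I_p * 'I_q) A ij.1 ij.2 * B ij.1 ij.2); last first.
  by apply: eq_bigr => -[i j] _ /=; rewrite mxE !mxvecE.
rewrite -(pair_bigA _ (fun i j => A i j * B i j)) /= exchange_big /=.
by apply: eq_bigr => j _; rewrite mxE; apply: eq_bigr => i _; rewrite mxE.
Qed.

(* The double-orthogonal theorem for the Frobenius pairing on matrices. *)
Lemma sum_images_of_orthogonal (R : fieldType) (a b c d p q : nat)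
    (f : {linear 'M[R]_(a, b) -> 'M[R]_(p, q)})
    (g : {linear 'M[R]_(c, d) -> 'M[R]_(p, q)}) (G : 'M[R]_(p, q)) :
  (forall D, (forall X, \tr ((f X)^T *m D) = 0) ->
             (forall Y, \tr ((g Y)^T *m D) = 0) -> \tr (G^T *m D) = 0) ->
  exists X Y, G = f X + g Y.
Proof.
move=> orthG.
suff /sub_addsmxP[[u v] /= Guv] : (mxvec G <= lin_mx f + lin_mx g)%MS.
  exists (vec_mx u), (vec_mx v); apply: (can_inj mxvecK).
  by rewrite Guv linearD /= !mul_rV_lin.
(* Membership in the row space means being killed by the cokernel [K]; each column of [K], reshaped
   into a matrix, is a [D] orthogonal to both images. *)
rewrite submxE; set K := cokermx _.
have fK : lin_mx f *m K = 0 by apply/eqP; rewrite -submxE addsmxSl.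
have gK : lin_mx g *m K = 0 by apply/eqP; rewrite -submxE addsmxSr.
have trK A j : \tr (A^T *m vec_mx (row j K^T)) = (mxvec A *m K) 0 j.
  by rewrite mxtrace_mxvec vec_mxK !mxE; apply: eq_bigr => k _; rewrite !mxE.
apply/eqP/matrixP => i j; rewrite ord1 [RHS]mxE -trK.
apply: orthG => X; rewrite trK -mul_vec_lin -mulmxA ?fK ?gK mulmx0 mxE //.
Qed.

(** * Bounds on quadratic forms *)

Section PosDef.
Context {R : realType}.

Lemma quad_col_sum d (A : 'M[R]_d) (v : 'cV[R]_d) :
  (v^T *m A *m v) 0 0 = \sum_i \sum_j A i j * (v i 0 * v j 0).
Proof.
rewrite mxE exchange_big /=; apply: eq_bigr => j _; rewrite mxE mulr_suml.
by apply: eq_bigr => i _; rewrite mxE; ring.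
Qed.

Lemma dot_col_sum d (v : 'cV[R]_d) : (v^T *m v) 0 0 = \sum_i v i 0 ^+ 2.
Proof. by rewrite mxE; apply: eq_bigr => i _; rewrite mxE expr2. Qed.

Lemma dot_col_gt0 d (v : 'cV[R]_d) : v != 0 -> 0 < (v^T *m v) 0 0.
Proof.
move=> v0; rewrite dot_col_sum lt_neqAle sumr_ge0 ?andbT; last first.
  by move=> i _; exact: sqr_ge0.
apply: contra v0; rewrite eq_sym => /eqP /psumr_eq0P v0; apply/eqP/colP => i.
by rewrite mxE; apply/eqP; rewrite -sqrf_eq0 v0 // => j _; exact: sqr_ge0.
Qed.

(** Each product |v_i| |v_j| is at most v^T v, so the sum of the |A_ij| is a bound; adding 1 keeps
    the constant positive even for [A = 0], so that it can serve as a divisor. *)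
Lemma quad_bound d (A : 'M[R]_d) : exists2 C : R, 0 < C &
  forall v : 'cV[R]_d, `|(v^T *m A *m v) 0 0| <= C * (v^T *m v) 0 0.
Proof.
have S0 : 0 <= \sum_i \sum_j `|A i j| by do 2 apply: sumr_ge0 => ? _.
exists (1 + \sum_i \sum_j `|A i j|); first by rewrite ltr_pwDl.
move=> v; have v0 : 0 <= (v^T *m v) 0 0.
  by rewrite dot_col_sum sumr_ge0 // => i _; exact: sqr_ge0.
rewrite mulrDl mul1r; apply: ler_wpDl => //.
rewrite quad_col_sum mulr_suml (le_trans (ler_norm_sum _ _ _)) //.
apply: ler_sum => i _; rewrite mulr_suml (le_trans (ler_norm_sum _ _ _)) //.
apply: ler_sum => j _; rewrite normrM ler_wpM2l //.
have vle k : `|v k 0| ^+ 2 <= (v^T *m v) 0 0.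
  rewrite dot_col_sum (bigD1 k) //= real_normK ?num_real // lerDl.
  by rewrite sumr_ge0 // => l _; exact: sqr_ge0.
rewrite normrM; have := vle i; have := vle j; move: (`|v i 0|) (`|v j 0|).
by move=> x y; nra.
Qed.

Lemma posdef_unitmx d (S : 'M[R]_d) : posdefmx S -> S \in unitmx.
Proof.
case=> _ S0; rewrite -row_free_unit -kermx_eq0; apply: contraT => /rowV0Pn[v].
move=> /sub_kermxP vS v0; have := S0 v^T; rewrite trmxK vS mul0mx mxE ltxx.
by rewrite trmx_eq0 => /(_ v0).
Qed.

(* Expand [0 <= (v - w / C)^T S (v - w / C)] for [w = S^-1 v], where
   [v^T S^-1 v <= C v^T v]. *)
Lemma posdef_coercive d (S : 'M[R]_d) : posdefmx S -> exists2 c : R, 0 < c &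
  forall v : 'cV[R]_d, c * (v^T *m v) 0 0 <= (v^T *m S *m v) 0 0.
Proof.
move=> Spd; have Su := posdef_unitmx Spd; case: Spd => St S0.
have [C C0 CP] := quad_bound (invmx S); exists C^-1; first by rewrite invr_gt0.
move=> v; set w := invmx S *m v; set x := v - C^-1 *: w.
have x0 : 0 <= (x^T *m S *m x) 0 0.
  have [->|/S0/ltW//] := eqVneq x 0.
  by rewrite trmx0 !mul0mx mxE.
have Sw : S *m w = v by rewrite mulKVmx.
have wS : w^T *m S = v^T by rewrite -[S in LHS]St -trmx_mul Sw.
have -> : (v^T *m S *m v) 0 0 =
    (x^T *m S *m x) 0 0 + C^-1 *+ 2 * (v^T *m v) 0 0
    - C^-1 ^+ 2 * (v^T *m invmx S *m v) 0 0.
  have -> : x^T = v^T - C^-1 *: w^T by apply/rowP => i; rewrite !mxE.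
  rewrite !(mulmxBl, mulmxBr) -!scalemxAr.
  rewrite -!scalemxAl wS -[v^T *m S *m w]mulmxA Sw -[v^T *m invmx S *m v]mulmxA.
  by rewrite -/w !mxE; ring.
have /(le_trans (ler_norm _)) := CP v; set q := (v^T *m v) 0 0.
set y := (v^T *m invmx S *m v) 0 0 => qy.
have : C^-1 ^+ 2 * y <= C^-1 * q.
  by rewrite expr2 -mulrA ler_pM2l ?invr_gt0 // ler_pdivrMl.
by rewrite mulrnAl mulr2n; move: x0; lra.
Qed.
End PosDef.

(** * Determinants along a line of matrices *)

(** As a formal polynomial, the determinant along a line can be differentiated algebraically and is
    continuous at once. *)
Definition det_pencil (R : comNzRingType) d (A B : 'M[R]_d) : {poly R} :=
  \det (map_mx polyC A + 'X *: map_mx polyC B).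

Lemma horner_det_pencil (R : comNzRingType) d (A B : 'M[R]_d) t :
  (det_pencil A B).[t] = \det (A + t *: B).
Proof.
rewrite -horner_evalE -det_map_mx; congr (\det _); apply/matrixP => i j.
by rewrite !mxE /= horner_evalE !hornerE.
Qed.

Lemma deriv_prod_1DXC (R : comNzRingType) (I : Type) (r : seq I) (a : I -> R) :
  (\prod_(i <- r) (1 + 'X * (a i)%:P))^`().[0] = \sum_(i <- r) a i.
Proof.
elim: r => [|i r IHr]; first by rewrite !big_nil derivC horner0.
rewrite !big_cons derivM hornerD !hornerM IHr horner_prod big1 => [|j _].
  by rewrite !poly.derivE !hornerE.
by rewrite !hornerE.
Qed.

(* A non-identity permutation displaces two indices, so it contributes a
   multiple of ['X^2] to the Leibniz formula. *)
Lemma deriv_det_pencil1 (R : comNzRingType) d (A : 'M[R]_d) :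
  (det_pencil 1%:M A)^`().[0] = \tr A.
Proof.
rewrite /det_pencil /determinant (bigD1 (1%g : 'S_d)) //= derivD hornerD.
rewrite [X in _ + X.[_]]raddf_sum horner_sum /= [X in _ + X]big1 ?addr0.
  rewrite odd_perm1 expr0 mul1r /mxtrace -deriv_prod_1DXC.
  by congr (_^`().[_]); apply: eq_bigr => i _; rewrite !mxE perm1 eqxx.
move=> s s1; have [i si] : exists i, s i != i.
  apply/existsP; apply: contraR s1 => /existsPn s1; apply/eqP/permP => i.
  by rewrite perm1; apply/eqP; rewrite -[_ == _]negbK s1.
rewrite (bigD1 i) //= (bigD1 (s i)) //= !mxE eq_sym (negbTE si).
rewrite (inj_eq perm_inj) eq_sym (negbTE si) /= !polyC0 !add0r.
by rewrite !poly.derivE !hornerE /= !(mulr0, mul0r) addr0.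
Qed.

(** The segment from [S] to the identity stays positive definite, hence invertible, so the
    determinant cannot vanish on it; it ends at 1. *)
Lemma posdef_det_gt0 (R : realType) d (S : 'M[R]_d) : posdefmx S -> 0 < \det S.
Proof.
move=> Spd; set p := det_pencil S (1%:M - S).
have p1 : p.[1] = 1 by rewrite horner_det_pencil scale1r addrC subrK det1.
have p0 : p.[0] = \det S by rewrite horner_det_pencil scale0r addr0.
rewrite ltNge; apply/negP => S0.
have [|t /andP[t0 t1]] := @poly_ivt R p 0 1 ler01.
  by rewrite p0 p1 S0 ler01.
rewrite rootE horner_det_pencil => /eqP det0.
suff /posdef_unitmx : posdefmx (S + t *: (1%:M - S)).
  by rewrite unitmxE det0 unitr0.
case: Spd => St Spos; split=> [|v v0].
  by rewrite linearD linearZ linearB /= trmx1 St.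
have -> : S + t *: (1%:M - S) = (1 - t) *: S + t *: 1%:M.
  by rewrite scalerBr scalerBl scale1r addrA addrAC.
rewrite mulmxDr mulmxDl -!(scalemxAl, scalemxAr) mulmx1 !mxE.
have := Spos v v0; have := dot_col_gt0 v0; rewrite !mxE.
case: (ltrgtP t 0) t0 => // [t0|->] _ sv sS; last by nra.
by case: (ltrgtP t 1) t1 => // [t1|->] _; nra.
Qed.

(** * First-order optimality *)

Lemma poly_max_deriv0 (R : realType) (p : {poly R}) (x e : R) : 0 < e ->
  (forall t, `|t - x| < e -> p.[t] <= p.[x]) -> p^`().[x] = 0.
Proof.
move=> e0 pmax; have pd := is_derive_poly p x.
have xe t : t \in `](x - e), (x + e)[ -> `|t - x| < e.
  by rewrite in_itv /= ltr_norml => /andP[? ?]; apply/andP; split; lra.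
have := @derive1_at_max R (horner p) (x - e) (x + e) x.
case=> [||||_ <-].
- lra.
- by move=> t _; exact: derivable_horner.
- by rewrite in_itv /=; apply/andP; split; lra.
- by move=> t /xe; exact: pmax.
- by rewrite (@derive_val _ _ _ _ _ _ _ pd).
Qed.

(** Coercivity of [S] with constant [c] absorbs the perturbation, whose form is at most |t| C v^T v,
    once |t| < c / C. *)
Lemma posdef_open (R : realType) d (S D : 'M[R]_d) : posdefmx S -> D^T = D ->
  exists2 e : R, 0 < e & forall t, `|t| < e -> posdefmx (S + t *: D).
Proof.
move=> Spd Dt; have [c c0 cP] := posdef_coercive Spd.
have [C C0 CP] := quad_bound D; exists (c / C); first exact: divr_gt0.
move=> t; rewrite ltr_pdivlMr // => tC; case: Spd => St _.
split=> [|v v0]; first by rewrite linearD linearZ /= St Dt.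
rewrite mulmxDr mulmxDl -!(scalemxAl, scalemxAr) mxE [X in _ + X]mxE.
have := cP v; have := CP v; have := dot_col_gt0 v0.
set q := (v^T *m v) 0 0; set y := (v^T *m D *m v) 0 0 => q0 yq sq.
have : `|t * y| < c * q.
  rewrite normrM (le_lt_trans (ler_wpM2l (normr_ge0 t) yq)) //.
  by rewrite mulrA ltr_pM2r.
rewrite ltr_norml => /andP[ty _]; lra.
Qed.

(* With [q t = det (1 + t S^-1 D)], minimality reads [ln (q t) <= t tau]; since
   [1 - t tau <= exp (- t tau)], the polynomial [q t * (1 - t tau)] is maximal
   at [t = 0]. *)
Lemma objective_stationary (R : realType) d (P S D : 'M[R]_d) (e : R) :
  posdefmx P -> 0 < e ->
  (forall t, `|t| < e -> posdefmx (S + t *: D)) ->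
  (forall t, `|t| < e -> objective P S <= objective P (S + t *: D)) ->
  \tr (invmx S *m D) = \tr (invmx P *m D).
Proof.
move=> Ppd e0 Spd Smin; set tau := \tr (invmx P *m D).
have S0 : posdefmx S by have := Spd 0; rewrite scale0r addr0 normr0; apply.
set q := det_pencil 1%:M (invmx S *m D).
have qE t : q.[t] = \det (S + t *: D) / \det S.
  rewrite horner_det_pencil -det_inv mulrC -det_mulmx mulmxDr mulVmx.
    by rewrite -scalemxAr.
  exact: posdef_unitmx.
have q0 : q.[0] = 1.
  by rewrite qE scale0r addr0 divff // gt_eqF // posdef_det_gt0.
have : (q * (1 - tau *: 'X))^`().[0] = 0.
  apply: (poly_max_deriv0 e0) => t; rewrite subr0 => te.
  have detS := posdef_det_gt0 S0; have detP := posdef_det_gt0 Ppd.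
  have detSt := posdef_det_gt0 (Spd t te).
  have qt0 : 0 < q.[t] by rewrite qE divr_gt0.
  have := Smin t te; rewrite /objective mulmxDr mxtraceD -scalemxAr mxtraceZ.
  rewrite -/tau !det_mulmx !det_inv.
  (* Splitting off [q.[t]] lets the remaining logarithm cancel between the two sides. *)
  have -> : (\det S)^-1 * \det P = ((\det (S + t *: D))^-1 * \det P) * q.[t].
    by rewrite qE; field; rewrite !gt_eqF.
  rewrite [X in X + _ <= _]lnM ?posrE ?mulr_gt0 ?invr_gt0 // => le.
  have lnq : ln q.[t] <= t * tau by lra.
  have : q.[t] <= expR (t * tau) by rewrite -(lnK qt0) ler_expR.
  rewrite -[expR _]invrK -expRN => qexp.
  rewrite !hornerE q0 ?mulr0 ?subr0 ?mulr1.
  have := expR_ge1Dx (- (t * tau)) => e1.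
  rewrite (@le_trans _ _ (q.[t] * expR (- (t * tau)))) //.
    by rewrite ler_pM2l //; lra.
  by rewrite -ler_pdivlMr ?expR_gt0 // mul1r.
(* Since q(0) = 1, the product rule at 0 leaves tr(S^-1 D) - tau. *)
rewrite derivM !poly.derivE !hornerE q0 deriv_det_pencil1.
by move=> h; lra.
Qed.

Lemma tr_mulmx_trl (R : comPzRingType) d (A B : 'M[R]_d) :
  \tr (A^T *m B) = \tr (A *m B^T).
Proof. by rewrite -[LHS]mxtrace_tr trmx_mul trmxK mxtrace_mulC. Qed.

(** Testing against the elementary matrices reads off the entries. *)
Lemma mxtrace_nondeg (R : comPzRingType) p q (A : 'M[R]_(p, q)) :
  (forall X : 'M[R]_(p, q), \tr (X^T *m A) = 0) -> A = 0.
Proof.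
move=> A0; apply/matrixP => i j; have := A0 (delta_mx i j).
rewrite trmx_delta mxE /mxtrace (bigD1 j) //= big1 => [|k kj].
  rewrite addr0 mxE (bigD1 i) //= big1 => [|k ki].
    by rewrite mxE !eqxx mul1r addr0.
  by rewrite mxE (negbTE ki) andbF mul0r.
by rewrite mxE big1 // => l _; rewrite mxE (negbTE kj) mul0r.
Qed.

Theorem mainTheorem3 (R : realType) (m n N : nat)
    (m_gt0 : (0 < m)%N) (n_gt0 : (0 < n)%N) (N_gt0 : (0 < N)%N)
    (le_nN : (n + 1 <= N)%N)
    (Sigma : 'I_n.+1 -> 'M[R]_m)
    (Sigma11_sym : (block_toeplitz Sigma)^T = block_toeplitz Sigma)
    (Sigma_p : 'M[R]_(bdim N m)) (Sigma_p_posdef : posdefmx Sigma_p)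
    (Sigma_c : 'M[R]_(bdim N m))
    (Sigma_c_opt :
      is_minimizer (objective Sigma_p)
        (@circulant_extensions R N n m (block_toeplitz Sigma)
           `&` @posdefmx R (bdim N m))
        Sigma_c) :
  let E := corner_embedding R N n m in
  let U := cyclic_shift R N m in
  exists (Lambda : 'M[R]_(bdim n.+1 m)) (Theta : 'M[R]_(bdim N m)),
    let Q := E *m Lambda *m E^T + U *m Theta *m U^T - Theta + invmx Sigma_p in
    [/\ Lambda^T = Lambda, Theta^T = Theta,
        Q \in unitmx & Sigma_c = invmx Q].
Proof.
move=> E U; case: Sigma_c_opt => -[[cT cE cU] cpd] cmin.
set P := invmx Sigma_p; set S := Sigma_c.
have Sunit : S \in unitmx := posdef_unitmx cpd.
have stationary D : D^T = D -> E^T *m D *m E = 0 -> U^T *m D *m U = D ->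
    \tr (invmx S *m D) = \tr (P *m D).
  move=> DT DE DU; have [e e0 Spd] := posdef_open cpd DT.
  apply: (objective_stationary Sigma_p_posdef e0) => [|t te]; first exact: Spd.
  apply: cmin; split; last exact: Spd.
  split; first by rewrite linearD linearZ /= cT DT.
    by rewrite mulmxDr mulmxDl cE -scalemxAr -scalemxAl DE scaler0 addr0.
  by rewrite mulmxDr mulmxDl cU -scalemxAr -scalemxAl DU.
set G := invmx S - P.
have GT : G^T = G.
  by rewrite linearB /= !trmx_inv cT (proj1 Sigma_p_posdef).
have [X [Y GE]] : exists X Y, G = (mulmxr E^T \o mulmx E) X +
    ((mulmxr U^T \o mulmx U) Y - Y).
  apply: (@sum_images_of_orthogonal _ _ _ _ _ _ _ (mulmxr E^T \o mulmx E)
    ((mulmxr U^T \o mulmx U) \- idfun)) => D orthE orthU.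
  have DE : E^T *m D *m E = 0.
    apply: mxtrace_nondeg => X; rewrite -[RHS](orthE X) /= !trmx_mul trmxK.
    by rewrite -!mulmxA [RHS]mxtrace_mulC !mulmxA.
  have DU : U^T *m D *m U = D.
    apply/eqP; rewrite -subr_eq0; apply/eqP; apply: mxtrace_nondeg => Y.
    rewrite -[RHS](orthU Y) /= mulmxBr linearB [in RHS]linearB /= mulmxBl.
    rewrite linearB /= !trmx_mul trmxK; congr (_ - _).
    by rewrite -!mulmxA [RHS]mxtrace_mulC !mulmxA.
  (* [D] need not be symmetric, whereas stationarity asks for it. Both constraints are stable under
     transposition, so [D + D^T] is admissible, and as [G] is symmetric it pairs with [G] to twice
     the pairing of [D]. *)
  have DsE : E^T *m (D + D^T) *m E = 0.
    rewrite mulmxDr mulmxDl DE add0r.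
    by rewrite -[RHS]trmx0 -DE !trmx_mul trmxK mulmxA.
  have DsU : U^T *m (D + D^T) *m U = D + D^T.
    rewrite mulmxDr mulmxDl DU; congr (_ + _).
    by rewrite -{2}DU !trmx_mul trmxK mulmxA.
  have DsT : (D + D^T)^T = D + D^T by rewrite linearD /= trmxK addrC.
  have /eqP := stationary _ DsT DsE DsU.
  rewrite -subr_eq0 -linearB /= -mulmxBl -/G mulmxDr linearD /= -tr_mulmx_trl GT.
  by rewrite -mulr2n mulrn_eq0 /= => /eqP.
(* Averaging the decomposition of [G] with its transpose gives symmetric multipliers. *)
exists (2^-1 *: (X + X^T)), (2^-1 *: (Y + Y^T)) => Q.
have symT d (Z : 'M[R]_d) : (2^-1 *: (Z + Z^T))^T = 2^-1 *: (Z + Z^T).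
  by rewrite linearZ /= linearD /= trmxK addrC.
have QE : Q = invmx S.
  rewrite -[RHS](subrK P) -/G; congr (_ + _).
  have -> : G = 2^-1 *: (G + G^T).
    by rewrite GT -mulr2n -[G *+ 2]scaler_nat scalerA mulVf ?scale1r ?pnatr_eq0.
  rewrite GE [(_ + _)^T]linearD /= [(_ - _)^T]linearB /= !trmx_mul !trmxK !mulmxA.
  rewrite /Q -!scalemxAr -!scalemxAl -addrA -scalerBr -scalerDr; congr (_ *: _).
  by rewrite !(mulmxDr, mulmxDl) opprD [RHS]addrACA; congr (_ + _); exact: addrACA.
by split; rewrite ?symT // QE ?unitmx_inv ?invmxK.
Qed.
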